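(* Fix the number of agents $n$ to be a constant. For mixed fair division instances $([n],[m],\mathcal{V})$ with additive integer valuations, each of the following two problems admits a pseudo-polynomial time algorithm: (i) compute an allocation of maximum utilitarian welfare among all EQX allocations, whenever an EQX allocation exists; (ii) compute an allocation of maximum egalitarian welfare among all EQX allocations, whenever an EQX allocation exists.
   Context: A (mixed) fair division instance $([n],[m],\mathcal{V})$ consists of $n$ agents, a set $O=[m]$ of $m$ indivisible items, and valuations $\mathcal{V}=\{v_1,\dots,v_n\}$ with $v_i:2^{[m]}\to\mathbb{Z}$ additive: $v_i(S)=\sum_{o\in S}v_i(o)$. Values may be positive, negative or zero. A (complete) allocation $A=(A_1,\dots,A_n)$ is a partition of the set of all items into $n$ (possibly empty) bundles, $A_i$ going to agent $i$. An allocation $A$ is EQX (equitable up to any item) if for every pair of agents $i,j$ with $v_i(A_i)<v_j(A_j)$: $v_i(A_i)\ge v_j(A_j\setminus\{g\})$ for all $g\in A_j$ with $v_j(g)\ge 0$, and $v_i(A_i\setminus\{c\})\ge v_j(A_j)$ for all $c\in A_i$ with $v_i(c)\le 0$. The utilitarian welfare of $A$ is $\frac1n\sum_{i\in[n]}v_i(A_i)$ and the egalitarian welfare of $A$ is $\min_{i\in[n]}v_i(A_i)$. Pseudo-polynomial time means time polynomial in the size of the input when the item values are encoded in unary (i.e. polynomial in $m$ and the absolute values of the item values, for constant $n$). *)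

(* Defs.v *)
From HB Require Import structures.
From mathcomp Require Import all_boot all_order all_algebra.

Set Implicit Arguments.
Unset Strict Implicit.
Unset Printing Implicit Defensive.

Import Order.TTheory GRing.Theory Num.Theory.
Local Open Scope ring_scope.

(** * Fair division *)

Section FairDivision.
Variables n m : nat.

(* An additive valuation is given by its values on single items. *)
Definition valuations := 'I_n -> 'I_m -> int.

Definition bundles := {ffun 'I_n -> {set 'I_m}}.

Definition value (v : valuations) (i : 'I_n) (S : {set 'I_m}) : int :=
  \sum_(o in S) v i o.

Definition is_allocation (A : bundles) : Prop :=
  (forall i j, i != j -> [disjoint A i & A j]) /\ \bigcup_i A i = [set: 'I_m].

Definition EQX (v : valuations) (A : bundles) : Prop :=
  forall i j, value v i (A i) < value v j (A j) ->
    (forall g, g \in A j -> 0 <= v j g ->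
       value v j (A j :\ g) <= value v i (A i)) /\
    (forall c, c \in A i -> v i c <= 0 ->
       value v j (A j) <= value v i (A i :\ c)).

Definition EQX_allocation (v : valuations) (A : bundles) : Prop :=
  is_allocation A /\ EQX v A.

Definition utilitarian (v : valuations) (A : bundles) : rat :=
  n%:R^-1 * (\sum_i value v i (A i))%:~R.

Definition max_EQX (d : Order.disp_t) (T : porderType d)
    (W : valuations -> bundles -> T) (v : valuations) (A : bundles) : Prop :=
  EQX_allocation v A /\
  forall B, EQX_allocation v B -> (W v B <= W v A)%O.

Definition unary_size (v : valuations) : nat :=
  (m + \sum_i \sum_o `|v i o|)%N.

End FairDivision.

Definition egalitarian (n m : nat) (v : valuations n.+1 m)
    (A : bundles n.+1 m) : int :=
  \big[Order.min/value v ord0 (A ord0)]_i value v i (A i).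

(** * Machine model *)

(* Structured programs for a random access machine with finitely many integer
   registers and integer arrays, under the uniform cost measure.  The only
   arithmetic operations are addition and subtraction, so that the integers
   arising in t steps have O(t + input length) bits: the uniform measure is then
   polynomially related to running time on a Turing machine.  A unit-cost
   multiplication would break this. *)

Inductive expr : Type :=
  | Const of int
  | Reg of nat
  | Read of nat & expr
  | Add of expr & expr
  | Sub of expr & expr.

Inductive test : Type :=
  | Le of expr & expr
  | Not of test
  | And of test & test.

Inductive prog : Type :=
  | Skip
  | Assign of nat & expr
  | Write of nat & expr & expr
  | Seq of prog & prog
  | If of test & prog & prog
  | While of test & prog.

Record state : Type := State { reg : nat -> int; arr : nat -> int -> int }.

Fixpoint eval (s : state) (e : expr) : int :=
  match e with
  | Const z => z
  | Reg x => reg s x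
  | Read a e1 => arr s a (eval s e1)
  | Add e1 e2 => eval s e1 + eval s e2
  | Sub e1 e2 => eval s e1 - eval s e2
  end.

Fixpoint holds (s : state) (b : test) : bool :=
  match b with
  | Le e1 e2 => eval s e1 <= eval s e2
  | Not b1 => ~~ holds s b1
  | And b1 b2 => holds s b1 && holds s b2
  end.

Definition set_reg (s : state) (x : nat) (z : int) : state :=
  State (fun y => if y == x then z else reg s y) (arr s).

Definition set_arr (s : state) (a : nat) (k z : int) : state :=
  State (reg s)
        (fun b l => if (b == a) && (l == k) then z else arr s b l).

(* [exec c s t s']: started in s, the program c halts in state s' after t steps.
   The expressions occurring in a program have bounded size, so charging one
   step per assignment or test only affects constant factors. *)
Inductive exec : prog -> state -> nat -> state -> Prop :=
  | ExecSkip s : exec Skip s 1 s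
  | ExecAssign s x e : exec (Assign x e) s 1 (set_reg s x (eval s e))
  | ExecWrite s a e1 e2 :
      exec (Write a e1 e2) s 1 (set_arr s a (eval s e1) (eval s e2))
  | ExecSeq c1 c2 s1 s2 s3 t1 t2 :
      exec c1 s1 t1 s2 -> exec c2 s2 t2 s3 -> exec (Seq c1 c2) s1 (t1 + t2) s3
  | ExecIfT b c1 c2 s t s' :
      holds s b -> exec c1 s t s' -> exec (If b c1 c2) s t.+1 s'
  | ExecIfF b c1 c2 s t s' :
      ~~ holds s b -> exec c2 s t s' -> exec (If b c1 c2) s t.+1 s'
  | ExecWhileT b c s1 s2 s3 t1 t2 :
      holds s1 b -> exec c s1 t1 s2 -> exec (While b c) s2 t2 s3 ->
      exec (While b c) s1 (t1 + t2).+1 s3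
  | ExecWhileF b c s : ~~ holds s b -> exec (While b c) s 1 s.

(* Register 0 holds m and, for i < n, cell o < m of array i holds v_i(o);
   everything else is 0. *)
Definition initial (n m : nat) (v : valuations n m) : state :=
  State (fun x => if x == 0%N then m%:Z else 0)
        (fun a k => if insub a is Some i then
                      if k is Posz o then
                        if insub o is Some o' then v i o' else 0
                      else 0
                    else 0).

(* The bundles are read off array n, whose cell o < m holds the (0-based) index
   of the agent receiving item o. *)
Definition outputs (n m : nat) (s : state) (A : bundles n m) : Prop :=
  forall (i : 'I_n) (o : 'I_m),
    (o \in A i) = (arr s n (o : nat)%:Z == (i : nat)%:Z).

(* For n agents, compute bundles satisfying [sol] on the instances satisfying
   [promise].  The program may depend on n only; it has to meet the time bound
   on every instance, but its output is unconstrained outside the promise. *)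
Definition pseudo_poly_time_computable (n : nat)
    (promise : forall m, valuations n m -> Prop)
    (sol : forall m, valuations n m -> bundles n m -> Prop) : Prop :=
  exists (c : prog) (p : {poly nat}), forall (m : nat) (v : valuations n m),
    exists (t : nat) (s : state),
      [/\ exec c (initial v) t s,
          (t <= p.[unary_size v])%N
        & promise m v -> exists A : bundles n m, outputs s A /\ sol m v A].

(* Main.v *)
(** Only three kinds of data about a partial allocation of the first items
    matter: the value of each bundle, and the smallest absolute value of a good
    and of a chore in it.  For constant n there are pseudo-polynomially many such
    summaries, and the summary after one more item depends only on the previous
    one.  A breadth-first search over summaries, with linear search for duplicates
    and parent pointers, therefore reaches the summary of every allocation; EQX
    and both welfares can be read off it, and a best feasible summary is traced
    back to an allocation. *)

Require Import Defs.
From HB Require Import structures.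
From mathcomp Require Import all_boot all_order all_algebra.
From mathcomp Require Import zify.

Set Implicit Arguments.
Unset Strict Implicit.
Unset Printing Implicit Defensive.

Import Order.TTheory GRing.Theory Num.Theory.

(** * Running time and total correctness *)

(** Total correctness with a time budget. The postcondition may itself be a [runs] statement, which
    is how the rules below chain commands in continuation style. *)
Definition runs (c : prog) (s : state) (T : nat) (Q : state -> Prop) : Prop :=
  exists t s', [/\ exec c s t s', t <= T & Q s'].

Lemma runs_weaken c s T T' (Q Q' : state -> Prop) :
  T <= T' -> (forall s', Q s' -> Q' s') -> runs c s T Q -> runs c s T' Q'.
Proof.
move=> TT' QQ' [t [s' [ex tT Qs']]].
by exists t, s'; split => //; [exact: leq_trans TT'|exact: QQ'].
Qed.

Lemma runs_le c s T T' (Q : state -> Prop) :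
  runs c s T Q -> T <= T' -> runs c s T' Q.
Proof. by move=> rT TT'; apply: runs_weaken rT. Qed.

Lemma runs_skip s (Q : state -> Prop) : Q s -> runs Skip s 1 Q.
Proof. by move=> Qs; exists 1, s; split => //; constructor. Qed.

Lemma runs_assign s x e (Q : state -> Prop) :
  Q (set_reg s x (eval s e)) -> runs (Assign x e) s 1 Q.
Proof. by move=> Qs; eexists 1, _; split; [constructor| |exact: Qs]. Qed.

Lemma runs_write s a e1 e2 (Q : state -> Prop) :
  Q (set_arr s a (eval s e1) (eval s e2)) -> runs (Write a e1 e2) s 1 Q.
Proof. by move=> Qs; eexists 1, _; split; [constructor| |exact: Qs]. Qed.

Lemma runs_seq c1 c2 s T1 T2 (Q : state -> Prop) :
  runs c1 s T1 (fun s1 => runs c2 s1 T2 Q) -> runs (Seq c1 c2) s (T1 + T2) Q.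
Proof.
move=> [t1 [s1 [ex1 tT1 [t2 [s2 [ex2 tT2 Qs]]]]]].
exists (t1 + t2), s2; split => //; last exact: leq_add.
by econstructor; eassumption.
Qed.

Lemma runs_if b c1 c2 s T (Q : state -> Prop) :
  (holds s b -> runs c1 s T Q) -> (~~ holds s b -> runs c2 s T Q) ->
  runs (If b c1 c2) s T.+1 Q.
Proof.
move=> H1 H2; case: (boolP (holds s b)) => hb.
  have [t [s' [ex tT Qs]]] := H1 hb.
  by exists t.+1, s'; split => //; apply: ExecIfT.
have [t [s' [ex tT Qs]]] := H2 hb.
by exists t.+1, s'; split => //; apply: ExecIfF.
Qed.

(** The index of the invariant is a variant that drops at each iteration, so there are at most [k]
    of them. Each costs [T] for the body and one for the test; the final failing test costs one
    more. *)
Lemma runs_while b c (I : nat -> state -> Prop) T :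
  (forall k s, I k s -> holds s b ->
     runs c s T (fun s' => exists2 k', k' < k & I k' s')) ->
  forall k s, I k s ->
  runs (While b c) s (T.+1 * k).+1
    (fun s' => ~~ holds s' b /\ exists k', I k' s').
Proof.
move=> body; elim/ltn_ind => k IH s Iks.
case: (boolP (holds s b)) => hb; last first.
  exists 1, s; split => //; first exact: ExecWhileF.
  by split => //; exists k.
have [t [s1 [ex tT [k' k'k Ik']]]] := body _ _ Iks hb.
have [t2 [s2 [ex2 t2T Qs]]] := IH _ k'k _ Ik'.
exists (t + t2).+1, s2; split => //; first exact: ExecWhileT ex ex2.
have : T.+1 * k'.+1 <= T.+1 * k by rewrite leq_mul2l k'k orbT.
by lia.
Qed.

(** A program may depend on the number of agents, so loops over agents and coordinates are expanded
    into straight-line code. *)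
Definition unroll (T : Type) (c : T -> prog) (xs : seq T) : prog :=
  foldr (fun x p => Seq (c x) p) Skip xs.

Lemma runs_unroll (X : Type) (c : X -> prog) (xs : seq X) T
    (P : seq X -> state -> Prop) s :
  (forall l x s1, P l s1 -> runs (c x) s1 T (P (rcons l x))) ->
  P [::] s -> runs (unroll c xs) s (T * size xs).+1 (P xs).
Proof.
(* The induction generalizes over the prefix already processed, which is empty at first. *)
move=> step; rewrite -{3}[xs]cat0s; elim: xs [::] s => [|x xs IH] l s Pl /=.
  by rewrite muln0 cats0; apply: runs_skip.
apply: (@runs_le _ _ (T + (T * size xs).+1)); last by rewrite mulnS; lia.
apply/runs_seq/(runs_weaken (leqnn T) _ (step _ _ _ Pl)) => s1 Ps1.
by rewrite -cat_rcons; apply: IH.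
Qed.

Definition all_test (X : Type) (b : X -> test) (xs : seq X) : test :=
  foldr (fun x t => And (b x) t) (Le (Const 0) (Const 0)) xs.

Lemma holds_all_test (X : Type) (b : X -> test) xs s :
  holds s (all_test b xs) = all (fun x => holds s (b x)) xs.
Proof. by elim: xs => //= x xs ->. Qed.

(** Adding [U] to every coordinate injects the vectors into functions from [K] to [2 * U + 1]
    values. Applied to summaries, the exponent depends on the number of agents only, hence the
    pseudo-polynomial bound. *)
Lemma size_box (K : finType) (es : seq {ffun K -> int}) (U : nat) :
  uniq es -> (forall e, e \in es -> forall k, `|e k| <= U) ->
  size es <= (2 * U + 1) ^ #|K|.
Proof.
move=> ues bnd.
pose code (e : {ffun K -> int}) : {ffun K -> 'I_(2 * U).+1} :=
  [ffun k => inord `|(e k + U%:Z)%R|].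
have code_inj : {in es &, injective code}.
  move=> e e' ee ee' /ffunP eq; apply/ffunP => k.
  move: (eq k) (bnd _ ee k) (bnd _ ee' k); rewrite !ffunE => /(congr1 val) /=.
  by move: (e k) (e' k) => x y + xU yU; rewrite !inordK; lia.
rewrite -(size_map code) -(card_uniqP _) ?map_inj_in_uniq //.
by rewrite (leq_trans (max_card _)) // card_ffun card_ord addn1.
Qed.

(** * Polynomial time bounds *)

Definition is_polynomial (f : nat -> nat) : Prop :=
  exists p : {poly nat}, forall x, f x = p.[x]%R.

Lemma is_polynomial_const c : is_polynomial (fun=> c).
Proof. by exists (c%:P)%R => x; rewrite hornerC. Qed.

Lemma is_polynomial_id : is_polynomial id.
Proof. by exists 'X%R => x; rewrite hornerX. Qed.

Lemma is_polynomial_add f g :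
  is_polynomial f -> is_polynomial g -> is_polynomial (fun x => f x + g x).
Proof. by move=> [p fE] [q gE]; exists (p + q)%R => x; rewrite hornerD fE gE. Qed.

Lemma is_polynomial_succ f : is_polynomial f -> is_polynomial (fun x => (f x).+1).
Proof.
move=> fP; have [p pE] := is_polynomial_add (is_polynomial_const 1) fP.
by exists p => x; rewrite -pE add1n.
Qed.

Lemma is_polynomial_mul f g :
  is_polynomial f -> is_polynomial g -> is_polynomial (fun x => f x * g x).
Proof. by move=> [p fE] [q gE]; exists (p * q)%R => x; rewrite hornerM fE gE. Qed.

Lemma is_polynomial_exp f k :
  is_polynomial f -> is_polynomial (fun x => f x ^ k).
Proof.
move=> fP; elim: k => [|k IH]; first exact: is_polynomial_const.
have [p pE] := is_polynomial_mul fP IH.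
by exists p => x; rewrite expnS pE.
Qed.

(** * The search program *)

Local Open Scope ring_scope.

Section Search.
Variable n : nat.
Local Notation agent := 'I_n.+1.

(* Component [None] counts the allocated items, [Some (None, i)] is the value of
   the bundle of i, and [Some (Some b, i)] is 1 plus the smallest absolute value
   of a good (b = true) or chore (b = false) in that bundle, or 0 if there is
   none; items of value 0 count as both.  The shift by 1 makes the all-zero
   memory encode the empty allocation. *)
Definition coord : Type := option (option bool * agent).
Definition entry := {ffun coord -> int}.

(** Negation turns chores into goods, so that one formula serves both kinds. *)
Definition signed (b : bool) (x : int) : int := if b then x else - x.

(** As [g] is shifted by 1, [1 <= g] and [g <= x] together say that a minimum is recorded and is
    strictly below [x]. *)
Definition update_min (g x : int) : int :=
  if (0 <= x) && ~~ ((1 <= g) && (g <= x)) then x + 1 else g.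

(** Items are handed out in increasing order, so the count [e None] is also the index of the next
    item. The function [d] stands for the content of the input arrays. *)
Definition step (d : nat -> int -> int) (e : entry) (i : agent) : entry :=
  [ffun k : coord => match k with
   | None => e None + 1
   | Some (c, j) =>
       if j == i then
         if c is Some b then update_min (e k) (signed b (d i (e None)))
         else e k + d i (e None)
       else e k
   end].

(** A word stands for a partial allocation: its letter at position o is the agent who receives item
    o. *)
Definition summary (d : nat -> int -> int) (w : seq agent) : entry :=
  foldl (step d) [ffun=> 0] w.

Lemma summary_rcons d w i :
  summary d (rcons w i) = step d (summary d w) i.
Proof. by rewrite /summary foldl_rcons. Qed.

Lemma summary_size d w : summary d w None = (size w)%:Z.
Proof.
elim/last_ind: w => [|w i IH]; first by rewrite /summary /= ffunE.
by rewrite summary_rcons ffunE IH size_rcons; lia.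
Qed.

(** The list of entries doubles as the queue: cells below [rLen] are occupied, and [rHead] is the
    next one to expand. [rScan] runs through the list in search of duplicates; [rBest] and [rCand]
    serve the final maximization. *)
Definition rLen := 1%N.
Definition rHead := 2%N.
Definition rScan := 3%N.
Definition rBest := 4%N.
Definition rCand := 5%N.
(** With n+1 agents, arrays 0 to n hold the input and array n+1 is where the output is read. All
    arrays from n+1 on are zero initially. *)
Definition aOut := n.+1.
Definition aParent := n.+2.
Definition aChoice := n.+3.
Definition aComp (k : coord) : nat := (n.+4 + enum_rank k)%N.

Lemma aComp_inj : injective aComp.
Proof. by move=> k k' /addnI /ord_inj /enum_rank_inj. Qed.

Definition field (r : nat) (k : coord) : expr := Read (aComp k) (Reg r).

Definition signed_expr (b : bool) (e : expr) : expr :=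
  if b then e else Defs.Sub (Const 0) e.

Definition put (a : nat) (e : expr) : prog := Write a (Reg rLen) e.

Definition comp_prog (i : agent) (k : coord) : prog :=
  let x := Read i (field rHead None) in
  match k with
  | None => put (aComp k) (Add (field rHead k) (Const 1))
  | Some (c, j) =>
      if j == i then
        if c is Some b then
          If (And (Le (Const 0) (signed_expr b x))
                  (Not (And (Le (Const 1) (field rHead k))
                            (Le (field rHead k) (signed_expr b x)))))
             (put (aComp k) (Add (signed_expr b x) (Const 1)))
             (put (aComp k) (field rHead k))
        else put (aComp k) (Add (field rHead k) x)
      else put (aComp k) (field rHead k)
  end.

Definition same_entry : test :=
  all_test (fun k => And (Le (field rScan k) (field rLen k))
                         (Le (field rLen k) (field rScan k))) (enum {: coord}).

(* The candidate is written just behind the list, where it also serves as the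
   sentinel of the linear search for an equal entry; it is added to the list by
   incrementing the length. *)
Definition agent_prog (i : agent) : prog :=
  Seq (unroll (comp_prog i) (enum {: coord}))
 (Seq (put aParent (Reg rHead))
 (Seq (put aChoice (Const i%:Z))
 (Seq (Assign rScan (Const 0))
 (Seq (While (Not same_entry) (Assign rScan (Add (Reg rScan) (Const 1))))
      (If (Le (Reg rLen) (Reg rScan))
          (Assign rLen (Add (Reg rLen) (Const 1))) Skip))))).

Definition search_prog : prog :=
  While (Not (Le (Reg rLen) (Reg rHead)))
    (Seq (If (Le (Reg 0) (field rHead None)) Skip
             (unroll agent_prog (enum 'I_n.+1)))
         (Assign rHead (Add (Reg rHead) (Const 1)))).

(** * Feasibility and comparison of summaries *)

(* The gap between the bundle values of j and i must not exceed the values of the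
   goods of j (b = true, k = j) or the absolute values of the chores of i
   (b = false, k = i). *)
Definition within_slack (b : bool) (e : entry) (i j k : agent) : bool :=
  ~~ ((1 <= e (Some (Some b, k))) &&
      (e (Some (Some b, k)) <= e (Some (None, j)) - e (Some (None, i)))).

(** The implication is spelled with negation and conjunction, the connectives of [test], so that the
    program evaluates the same formula. *)
Definition eqx_entry (e : entry) : bool :=
  all (fun p : agent * agent => let: (i, j) := p in
         ~~ ((e (Some (None, i)) < e (Some (None, j))) &&
             ~~ (within_slack true e i j j && within_slack false e i j i)))
      (enum {: agent * agent}).

Definition feasible (m : nat) (e : entry) : bool :=
  (e None == m%:Z) && eqx_entry e.

(* Infeasible entries are placed below all others, so that a single maximization
   over a total preorder both finds a feasible entry and optimizes it. *)
Definition preferred (obj : entry -> int) (m : nat) (e e' : entry) : bool :=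
  ~~ (feasible m e && ~~ (feasible m e' && (obj e <= obj e'))).

Definition slack_test (b : bool) (f : coord -> expr) (i j k : agent) : test :=
  Not (And (Le (Const 1) (f (Some (Some b, k))))
           (Le (f (Some (Some b, k)))
               (Defs.Sub (f (Some (None, j))) (f (Some (None, i)))))).

Definition feasible_test (f : coord -> expr) : test :=
  And (And (Le (f None) (Reg 0)) (Le (Reg 0) (f None)))
      (all_test (fun p : agent * agent => let: (i, j) := p in
         Not (And (Not (Le (f (Some (None, j))) (f (Some (None, i)))))
                  (Not (And (slack_test true f i j j) (slack_test false f i j i)))))
       (enum {: agent * agent})).

Definition preferred_test (obj_test : (coord -> expr) -> (coord -> expr) -> test)
    (f g : coord -> expr) : test :=
  Not (And (feasible_test f) (Not (And (feasible_test g) (obj_test f g)))).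

Definition select_prog obj_test : prog :=
  Seq (Assign rBest (Const 0)) (Seq (Assign rCand (Const 0))
    (While (Not (Le (Reg rLen) (Reg rCand)))
      (Seq (If (preferred_test obj_test (field rBest) (field rCand))
               (Assign rBest (Reg rCand)) Skip)
           (Assign rCand (Add (Reg rCand) (Const 1)))))).

(** An entry counting c > 0 items arose from its parent by giving item c-1 to the agent stored in
    [aChoice]; the trace ends at count 0. *)
Definition output_prog : prog :=
  While (Le (Const 1) (field rBest None))
    (Seq (Write aOut (Defs.Sub (field rBest None) (Const 1))
                     (Read aChoice (Reg rBest)))
         (Assign rBest (Read aParent (Reg rBest)))).

Definition main_prog obj_test : prog :=
  Seq (Assign rLen (Const 1))
 (Seq search_prog
 (Seq (select_prog obj_test) output_prog)).

(** [N] bounds the number of entries when all components are at most [U] in absolute value. The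
    summands pay for the first assignment, the search, the selection and the trace. *)
Definition time_bound (U m : nat) : nat :=
  let N := ((2 * U + 1) ^ #|{: coord}|)%N in
  (1 + ((((((2 * #|{: coord}| + 2 * N + 7) * n.+1).+2 + 1).+1 * N).+1) +
        (4 * N + 3 + (3 * m).+1)))%N.

(** * Correctness of the breadth-first search *)

Section Instance.
Variables (d : nat -> int -> int) (m : nat).
Local Notation summary := (summary d).

Definition stored (s : state) (w : seq agent) (j : nat) : Prop :=
  forall k, arr s (aComp k) j%:Z = summary w k.

(** The words [ws] are ghost data: memory holds only their summaries, with a parent and a last
    letter for each nonempty word. Parent pointers cannot cycle because the parent's word is
    shorter. Uniqueness of summaries is what bounds the length of the list. *)
Record encodes (ws : seq (seq agent)) (s : state) : Prop := Encodes {
  enc_items : reg s 0 = m%:Z;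
  enc_len : reg s rLen = (size ws)%:Z;
  enc_input : forall (i : agent) k, arr s i k = d i k;
  enc_stored : forall j, (j < size ws)%N -> stored s (nth [::] ws j) j;
  enc_parent : forall j, (j < size ws)%N -> (0 < size (nth [::] ws j))%N ->
    exists p (i : agent), [/\ (p < size ws)%N, arr s aParent j%:Z = p%:Z,
      arr s aChoice j%:Z = i%:Z & nth [::] ws j = rcons (nth [::] ws p) i];
  enc_uniq : uniq (map summary ws);
  enc_size : all (fun w => size w <= m)%N ws;
  enc_nil : [::] \in ws }.

(** Only cell [l] of the non-input arrays may change. With [l] the length of the list, this is the
    scratch cell of the candidate. *)
Definition agree_off (l : nat) (s s' : state) : Prop :=
  forall a k, (a <= n)%N || (k != l%:Z) -> arr s' a k = arr s a k.

Lemma agree_off_set l s s' a z :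
  (n < a)%N -> agree_off l s s' -> agree_off l s (set_arr s' a l%:Z z).
Proof.
move=> na agr b k hbk /=; case: ifP => [/andP[/eqP ba /eqP kl]|_]; last exact: agr.
by move: hbk; rewrite ba kl eqxx leqNgt na.
Qed.

Lemma encodes_agree ws s s' :
  encodes ws s -> agree_off (size ws) s s' ->
  reg s' 0 = reg s 0 -> reg s' rLen = reg s rLen -> encodes ws s'.
Proof.
case=> e1 e2 e3 e4 e5 e6 e7 e8 agr r0 r1.
have agrl a j : (j < size ws)%N -> arr s' a j%:Z = arr s a j%:Z.
  by move=> jl; apply: agr; rewrite eqz_nat (ltn_eqF jl) orbT.
split => //; rewrite ?r0 ?r1 //.
- by move=> i k; rewrite agr ?e3 // -ltnS ltn_ord.
- by move=> j jl k; rewrite agrl // e4.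
- move=> j jl hj; have [p [i [? ? ? ?]]] := e5 _ jl hj.
  by exists p, i; split => //; rewrite agrl.
Qed.

Lemma eval_signed s b e : eval s (signed_expr b e) = signed b (eval s e).
Proof. by case: b => //=; rewrite sub0r. Qed.

Lemma runs_comp s w i k h l (Q : state -> Prop) :
  reg s rLen = l%:Z -> reg s rHead = h%:Z -> stored s w h ->
  (forall (i : agent) k, arr s i k = d i k) ->
  Q (set_arr s (aComp k) l%:Z (step d (summary w) i k)) ->
  runs (comp_prog i k) s 2 Q.
Proof.
move=> rL rH sw input; rewrite ffunE /comp_prog => HQ.
have fld k' : eval s (field rHead k') = summary w k' by rewrite /= rH sw.
have itm : eval s (Read i (field rHead None)) = d i (summary w None).
  by rewrite -fld -input.
have one z e : Q (set_arr s (aComp k) l%:Z z) -> eval s e = z ->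
    runs (put (aComp k) e) s 1 Q.
  by move=> + ez; rewrite -ez => ?; apply: runs_write; rewrite /= rL.
case: k HQ fld one => [[c j]|] HQ fld one; last first.
  by apply: (@runs_le _ _ 1) => //; apply: one HQ _; rewrite /= -fld.
case: eqVneq HQ one => [->|ji] HQ one; last first.

  by apply: (@runs_le _ _ 1) => //; apply: one HQ _; rewrite /= -fld.
case: c HQ fld one => [b|] HQ fld one; last first.
  by apply: (@runs_le _ _ 1) => //; apply: one HQ _; rewrite -fld -itm.
have sgn : eval s (signed_expr b (Read i (field rHead None))) =
    signed b (d i (summary w None)).
  by rewrite eval_signed itm.
have cond : holds s (And (Le (Const 0) (signed_expr b (Read i (field rHead None))))
   (Not (And (Le (Const 1) (field rHead (Some (Some b, i))))
      (Le (field rHead (Some (Some b, i)))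
         (signed_expr b (Read i (field rHead None))))))) =
   (0 <= signed b (d i (summary w None))) &&
   ~~ ((1 <= summary w (Some (Some b, i))) &&
       (summary w (Some (Some b, i)) <= signed b (d i (summary w None)))).
  by rewrite -sgn -!fld.
apply: runs_if; rewrite cond => hc; move: HQ; rewrite /update_min ?hc ?(negbTE hc) => HQ.
  by apply: one HQ _; rewrite -sgn.
by apply: one HQ _; rewrite -fld.
Qed.

Lemma holds_same_entry s w w' j l :
  stored s w j -> stored s w' l -> reg s rScan = j%:Z -> reg s rLen = l%:Z ->
  holds s same_entry = (summary w == summary w').
Proof.
move=> sj sl rS rL; rewrite holds_all_test.
apply/allP/eqP => [H|eqw k _] /=; last by rewrite rS rL sj sl eqw lexx.
apply/ffunP => k; have /= := H k (mem_enum _ k).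
by rewrite rS rL sj sl -eq_le => /eqP.
Qed.

(** The candidate sits at index [size ws] as a sentinel, so the scan stops there at the latest, and
    it stops earlier exactly for a duplicate. *)
Lemma runs_scan ws s w :
  encodes ws s -> stored s w (size ws) -> reg s rScan = 0 ->
  runs (While (Not same_entry) (Assign rScan (Add (Reg rScan) (Const 1)))) s
    (2 * size ws).+1
    (fun s' => [/\ arr s' = arr s, forall x, x != rScan -> reg s' x = reg s x &
       exists j, [/\ reg s' rScan = j%:Z, (j <= size ws)%N &
         (j < size ws)%N = (summary w \in map summary ws)]]).
Proof.
move=> enc sw r0.
pose I k s' := [/\ arr s' = arr s, forall x, x != rScan -> reg s' x = reg s x &
  exists j, [/\ reg s' rScan = j%:Z, (j + k)%N = size ws &
    forall j', (j' < j)%N -> summary (nth [::] ws j') != summary w]].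
have stest s' j w' k : I k s' -> reg s' rScan = j%:Z -> stored s w' j ->
    holds s' same_entry = (summary w' == summary w).
  move=> [ar rg _] rS sw'; apply: holds_same_entry rS _ => //.
  - by rewrite /stored ar.
  - by rewrite /stored ar; exact: sw.
  - by rewrite rg // (enc_len enc).
apply: (runs_weaken (leqnn _) _ (@runs_while _ _ I 1 _ (size ws) s _)); last first.
- by split => //; exists 0%N.
- move=> k s' Ik /= hn; have [ar rg [j [rS jk Hj]]] := Ik.
  apply: runs_assign.
  (* At the sentinel the candidate would be compared with itself and the loop would have stopped. *)
  have jl : (j < size ws)%N.
    rewrite ltnNge; apply/negP => lj; have jE : j = size ws by lia.
    by move: hn; rewrite (stest _ j w _ Ik) ?eqxx // jE.
  exists k.-1; first by lia.
  split => //.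
    by move=> x xS /=; rewrite (negbTE xS) rg.
  exists j.+1; split; rewrite /= ?eqxx ?rS; [by lia|by lia|].
  move=> j'; rewrite ltnS leq_eqVlt => /orP[/eqP ->|]; last exact: Hj.
  by rewrite -(stest _ j _ _ Ik) //; apply: enc_stored enc _ jl.
move=> s' /= [/negPn hn [k Ik]]; have [ar rg [j [rS jk Hj]]] := Ik.
split => //; exists j; split => //; first by lia.
case: ltnP => jl.
  move: hn; rewrite (stest _ j _ _ Ik rS (enc_stored enc jl)) => /eqP <-.
  by apply/esym/map_f/mem_nth.
apply/esym/negP => /(nthP (summary [::])) [j' j'l].
rewrite size_map in j'l; rewrite (nth_map [::]) // => /eqP.
by apply/negP/Hj; apply: leq_trans jl.
Qed.

(** The list grows by [rcons w i] if the scan reaches the sentinel, and is unchanged otherwise; the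
    summary of [rcons w i] is listed either way. *)
Lemma runs_agent ws s i h :
  let w := nth [::] ws h in
  encodes ws s -> reg s rHead = h%:Z -> (h < size ws)%N -> (size w < m)%N ->
  runs (agent_prog i) s (2 * #|{: coord}| + 2 * size ws + 7)
    (fun s' => exists zs, [/\ encodes (ws ++ zs) s', reg s' rHead = h%:Z &
       summary (rcons w i) \in map summary (ws ++ zs)]).
Proof.
move=> w enc rH hl wm; set l := size ws.
(* This covers the scan and the conditional insertion, once the candidate has been written
   completely. *)
have post s4 : agree_off l s s4 -> (forall x, x != rScan -> reg s4 x = reg s x) ->
    reg s4 rScan = 0 -> stored s4 (rcons w i) l ->
    arr s4 aParent l%:Z = h%:Z -> arr s4 aChoice l%:Z = i%:Z ->
    runs (Seq (While (Not same_entry) (Assign rScan (Add (Reg rScan) (Const 1))))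
      (If (Le (Reg rLen) (Reg rScan))
          (Assign rLen (Add (Reg rLen) (Const 1))) Skip)) s4 ((2 * l).+1 + 2)
    (fun s' => exists zs, [/\ encodes (ws ++ zs) s', reg s' rHead = h%:Z &
       summary (rcons w i) \in map summary (ws ++ zs)]).
  move=> agr rg rS sw par cho.
  have enc4 : encodes ws s4 by apply: encodes_agree enc agr _ _; rewrite rg.
  apply/runs_seq/(runs_weaken (leqnn _) _ (runs_scan enc4 sw rS)).
  move=> s5 [ar5 rg5 [j [rS5 jl jin]]].
  have enc5 : encodes ws s5.
    by apply: encodes_agree enc4 _ _ _; rewrite ?rg5 // => a k _; rewrite ar5.
  have rH5 : reg s5 rHead = h%:Z by rewrite rg5 // rg.
  apply: runs_if => /=; rewrite rS5 (enc_len enc5) lez_nat -?ltnNge; last first.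
    rewrite jin => win; apply: runs_skip; exists [::].
    by rewrite cats0.
  rewrite leqNgt jin => win; apply: runs_assign; exists [:: rcons w i].
  split; rewrite ?map_cat ?mem_cat ?mem_head ?orbT //.
  have [e1 e2 e3 e4 e5 e6 e7 e8] := enc5.
  have nthS j' : (j' < size (ws ++ [:: rcons w i]))%N ->
      (j' < l)%N /\ nth [::] (ws ++ [:: rcons w i]) j' = nth [::] ws j' \/
      j' = l /\ nth [::] (ws ++ [:: rcons w i]) j' = rcons w i.
    rewrite nth_cat size_cat addn1 ltnS leq_eqVlt => /orP[/eqP ->|jj].
      by right; rewrite ltnn subnn.
    by left; rewrite jj.
  split => //=.
  - by rewrite e2 size_cat addn1 intS addrC.
  - by move=> j' /nthS[[jj ->] k|[-> ->] k]; [exact: e4|rewrite ar5 sw].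
  - move=> j' /nthS[[jj ->]|[-> ->]].
      move=> /(e5 _ jj)[p [i' [pl ? ? pi]]]; exists p, i'.
      by rewrite size_cat nth_cat pl; split => //; lia.
    move=> _; exists h, i; rewrite ar5 size_cat nth_cat hl; split => //; lia.
  - rewrite map_cat cat_uniq e6 /= orbF andbT; exact: win.
  - by rewrite all_cat e7 /= size_rcons wm.
  - by rewrite mem_cat e8.
pose P (ks : seq coord) s1 := [/\ agree_off l s s1, forall x, reg s1 x = reg s x &
  forall k, k \in ks -> arr s1 (aComp k) l%:Z = step d (summary w) i k].
apply: (@runs_le _ _ ((2 * size (enum {: coord})).+1 +
                      (1 + (1 + (1 + ((2 * l).+1 + 2)))))%N); last first.
  by rewrite cardE; move: (size (enum _)) => a; lia.
apply: runs_seq; apply: (runs_weaken (leqnn _) _ (@runs_unroll _ _ _ 2 P _ _ _)).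
- move=> s1 [agr rg sl].
  apply/runs_seq/runs_write/runs_seq/runs_write/runs_seq/runs_assign => /=.
  rewrite !rg rH (enc_len enc) -/l.
  apply: post => //=.
  + have agr2 : agree_off l s
        (set_arr (set_arr s1 aParent l%:Z h%:Z) aChoice l%:Z i%:Z).
      apply: agree_off_set; first by rewrite /aChoice; lia.
      by apply: agree_off_set => //; rewrite /aParent; lia.
    by move=> a k; apply: agr2.
  + by move=> x xS /=; rewrite (negbTE xS) rg.
  + move=> k /=; rewrite sl ?mem_enum // summary_rcons.
    have lt : (aChoice < aComp k)%N by apply: ltn_addr.
    by rewrite (gtn_eqF lt) (gtn_eqF (ltnW lt)).
  + by rewrite /aChoice /aParent !eqxx (ltn_eqF (ltnSn _)).
  + by rewrite !eqxx.
- move=> ks k s1 [agr rg sl].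
  apply: (@runs_comp _ w _ _ h l) => //.
  + by rewrite rg (enc_len enc).
  + by rewrite rg.
  + move=> k'; rewrite agr ?(enc_stored enc) //.
    by rewrite eqz_nat (ltn_eqF hl) orbT.
  + by move=> j z; rewrite agr ?(enc_input enc) // -ltnS ltn_ord.
  split => //=.
  + by apply: agree_off_set => //; rewrite /aComp; lia.
  + move=> k'; rewrite mem_rcons inE eqxx andbT (inj_eq aComp_inj).
    by case: eqVneq => [->//|_] /=; exact: sl.
- by split.
Qed.

Definition closed_upto (ws : seq (seq agent)) (h : nat) : Prop :=
  forall j, (j < h)%N -> (size (nth [::] ws j) < m)%N ->
  forall i, summary (rcons (nth [::] ws j) i) \in map summary ws.

(** By induction, the prefix of the word shares its summary with some listed word, of the same
    length since the count is part of the summary. A step depends on the summary alone, so extending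
    either word gives the same summary, and the extension of the listed word is covered by
    closure. *)
Lemma closed_upto_all ws w :
  [::] \in ws -> closed_upto ws (size ws) -> (size w <= m)%N ->
  summary w \in map summary ws.
Proof.
move=> nilw cl; elim/last_ind: w => [_|w i IH]; first exact: map_f.
rewrite size_rcons => wm; have /(nthP (summary [::])) [j] := IH (ltnW wm).
rewrite size_map => jl; rewrite (nth_map [::]) // => eqw.
rewrite summary_rcons -eqw -summary_rcons; apply: cl => //.
by rewrite -ltz_nat -(summary_size d) eqw summary_size ltz_nat.
Qed.

(** Every iteration advances the head, which never passes the end of a list of length at most [N].
    When it meets the end, the list is closed under extension. *)
Lemma runs_search N s :
  (forall ws s', encodes ws s' -> (size ws <= N)%N) ->
  encodes [:: [::]] s -> reg s rHead = 0 ->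
  runs search_prog s
    ((((2 * #|{: coord}| + 2 * N + 7) * n.+1).+2 + 1).+1 * N).+1
    (fun s' => exists2 ws, encodes ws s' &
       forall w, (size w <= m)%N -> summary w \in map summary ws).
Proof.
move=> bnd enc0 rH0.
pose I k s' := exists ws h, [/\ encodes ws s', reg s' rHead = h%:Z,
  (h <= size ws)%N, (h + k)%N = N & closed_upto ws h].
apply: (runs_weaken (leqnn _) _ (@runs_while _ _ I
  (((2 * #|{: coord}| + 2 * N + 7) * n.+1).+2 + 1) _ N s _)).
- move=> s' /= [/negPn + [k [ws [h [enc rH hl _ cl]]]]].
  rewrite rH (enc_len enc) lez_nat => lh; exists ws => //.
  have hE : h = size ws by apply/eqP; rewrite eqn_leq hl.
  by move=> w; apply: closed_upto_all (enc_nil enc) _; rewrite -hE.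
- move=> k s1 [ws [h [enc rH _ hk cl]]] /=.
  rewrite rH (enc_len enc) lez_nat -ltnNge => hl.
  set w := nth [::] ws h.
  pose Q s2 := exists zs, [/\ encodes (ws ++ zs) s2, reg s2 rHead = h%:Z &
    (size w < m)%N -> forall i, summary (rcons w i) \in map summary (ws ++ zs)].
  apply/runs_seq; apply: (@runs_weaken _ _ _ _ Q).
  + exact: leqnn.
  + move=> s2 [zs [enc2 rH2 all_i]]; apply: runs_assign.
    have Nl := bnd _ _ enc2.
    exists k.-1; first by move: Nl; rewrite size_cat; lia.
    exists (ws ++ zs), h.+1; split.
    * by apply: encodes_agree enc2 _ _ _ => // a k'.
    * by rewrite /= rH2; lia.
    * by rewrite size_cat; lia.
    * by move: Nl; rewrite size_cat; lia.
    move=> j; rewrite ltnS leq_eqVlt => /orP[/eqP ->|jh].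
      by rewrite nth_cat hl; exact: all_i.
    rewrite nth_cat (ltn_trans jh hl) => jm i.
    by rewrite map_cat mem_cat cl.
  apply: runs_if => /=; rewrite (enc_items enc) rH (enc_stored enc hl) summary_size lez_nat => hm.
    apply: (@runs_le _ _ 1) => //; apply: runs_skip.
    by exists [::]; rewrite cats0; split => //; rewrite ltnNge hm.
  rewrite -ltnNge in hm.
  pose P (l : seq agent) s2 := exists zs, [/\ encodes (ws ++ zs) s2,
    reg s2 rHead = h%:Z &
    forall i, i \in l -> summary (rcons w i) \in map summary (ws ++ zs)].
  rewrite -[X in (_ * X).+1](size_enum_ord).
  apply: (runs_weaken (leqnn _) _ (@runs_unroll _ _ _ _ P _ _ _)).
  + move=> s2 [zs [enc2 rH2 all_i]]; exists zs; split => // _ i.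
    by apply: all_i; rewrite mem_enum.
  + move=> l i s2 [zs [enc2 rH2 all_i]].
    have hl2 : (h < size (ws ++ zs))%N by rewrite size_cat; lia.
    have wE : nth [::] (ws ++ zs) h = w by rewrite nth_cat hl.
    have := @runs_agent (ws ++ zs) s2 i h enc2 rH2 hl2.
    rewrite wE => /(_ hm); apply: runs_weaken.
      by have := bnd _ _ enc2; move: #|_| => a; lia.
    move=> s3 [zs' [enc3 rH3 in3]]; exists (zs ++ zs'); rewrite catA; split => //.
    move=> i'; rewrite mem_rcons inE => /orP[/eqP -> //|/all_i].
    by rewrite [in X in _ -> X]map_cat mem_cat => ->.
  by exists [::]; rewrite cats0.
- exists [:: [::]], 0%N; split => //.
Qed.

(** * Tracing an entry back to a word *)

Lemma runs_output ws s b :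
  let w := nth [::] ws b in
  encodes ws s -> reg s rBest = b%:Z -> (b < size ws)%N ->
  runs output_prog s (3 * size w).+1
    (fun s' => forall o, (o < size w)%N -> arr s' aOut o%:Z = nth ord0 w o).
Proof.
move=> w enc rB bl; have wb : w = nth [::] ws b by [].
clearbody w.
have po : aParent != aOut by rewrite neq_ltn ltnSn orbT.
have co : aChoice != aOut by rewrite gtn_eqF // ltnW // ltnSn.
(* The current entry encodes a prefix of [w], and the letters of the remaining suffix [w'] are
   already in the output array. *)
pose I k s' := exists b' w', [/\ w = nth [::] ws b' ++ w', reg s' rBest = b'%:Z,
  (b' < size ws)%N, size (nth [::] ws b') = k &
  (forall a k', a != aOut -> arr s' a k' = arr s a k') /\
  (forall o, (size (nth [::] ws b') <= o < size w)%N ->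
     arr s' aOut o%:Z = nth ord0 w o)].
have fieldE b' s' : reg s' rBest = b'%:Z -> (b' < size ws)%N ->
    (forall a k', a != aOut -> arr s' a k' = arr s a k') ->
    arr s' (aComp None) (reg s' rBest) = (size (nth [::] ws b'))%:Z.
  move=> -> b'l agr; rewrite agr ?(enc_stored enc) ?summary_size //.
  by rewrite /aComp /aOut; lia.
apply: (runs_weaken (leqnn _) _ (@runs_while _ _ I 2 _ _ s _)).
- move=> s' [/= + [k [b' [w' [_ rB' b'l _ [agr out]]]]]].
  rewrite (fieldE b') // => sz o ow; apply: out.
  by rewrite ow andbT; move: sz; rewrite lez_nat -leqNgt leqn0 => /eqP ->.
- move=> k s1 [b' [w' [wE rB' b'l szk [agr out]]]] /=.
  rewrite (fieldE b') // lez_nat => sz.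
  have [p [i [pl par cho pE]]] := enc_parent enc b'l sz.
  apply: (@runs_le _ _ (1 + 1)) => //.
  apply: runs_seq; apply: runs_write; apply: runs_assign.
  rewrite /= (fieldE b') //=.
  have szp : size (nth [::] ws b') = (size (nth [::] ws p)).+1.
    by rewrite pE size_rcons.
  exists (size (nth [::] ws p)); first by lia.
  exists p, (i :: w'); split => //.
  + by rewrite wE pE cat_rcons.
  + by rewrite /= (negbTE po) rB' /= agr.
  split.
    by move=> a k' ha /=; rewrite (negbTE ha) /= agr.
  move=> o /andP[le_po ow] /=; rewrite eqxx /=.
  have -> : (o%:Z == (size (nth [::] ws b'))%:Z - 1) = (o == size (nth [::] ws p)).
    by rewrite szp; lia.
  case: eqVneq => [->|op]; last by apply: out; rewrite szp; lia.
  by rewrite wE pE cat_rcons nth_cat ltnn subnn /= rB' agr.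
- exists b, [::]; rewrite cats0 -wb; split => //; split => // o.
  by move=> /andP[h1 h2]; lia.
Qed.

(** * Selecting a best feasible summary *)

Section Objective.
Variables (obj : entry -> int)
  (obj_test : (coord -> expr) -> (coord -> expr) -> test).
Hypothesis holds_obj_test : forall s f g (e e' : entry),
  (forall k, eval s (f k) = e k) -> (forall k, eval s (g k) = e' k) ->
  holds s (obj_test f g) = (obj e <= obj e').

Lemma holds_feasible_test s f (e : entry) :
  (forall k, eval s (f k) = e k) -> reg s 0 = m%:Z ->
  holds s (feasible_test f) = feasible m e.
Proof.
move=> fe r0; rewrite /= r0 fe -eq_le /feasible; congr (_ && _).
rewrite holds_all_test; apply: eq_all => -[i j] /=.
by rewrite !fe -!ltNge.
Qed.

Lemma holds_preferred_test s f g (e e' : entry) :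
  (forall k, eval s (f k) = e k) -> (forall k, eval s (g k) = e' k) ->
  reg s 0 = m%:Z ->
  holds s (preferred_test obj_test f g) = preferred obj m e e'.
Proof.
move=> fe ge r0.
change (~~ (holds s (feasible_test f) &&
  ~~ (holds s (feasible_test g) && holds s (obj_test f g))) = preferred obj m e e').
by rewrite (holds_feasible_test fe r0) (holds_feasible_test ge r0)
  (holds_obj_test fe ge).
Qed.

Lemma preferred_refl e : preferred obj m e e.
Proof. by rewrite /preferred lexx andbT; case: feasible. Qed.

Lemma preferred_trans e1 e2 e3 :
  preferred obj m e1 e2 -> preferred obj m e2 e3 -> preferred obj m e1 e3.
Proof.
rewrite /preferred; do 3 case: feasible => //=.
by rewrite !negbK; exact: le_trans.
Qed.

Lemma preferred_total e1 e2 : ~~ preferred obj m e1 e2 -> preferred obj m e2 e1.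
Proof.
rewrite /preferred; do 2 case: feasible => //=.
by rewrite !negbK -ltNge => /ltW.
Qed.

Lemma runs_select ws s :
  encodes ws s ->
  runs (select_prog obj_test) s (4 * size ws + 3)
    (fun s' => encodes ws s' /\ exists b, [/\ reg s' rBest = b%:Z, (b < size ws)%N &
       forall j, (j < size ws)%N ->
         preferred obj m (summary (nth [::] ws j)) (summary (nth [::] ws b))]).
Proof.
move=> enc.
pose I k s' := encodes ws s' /\ exists b c, [/\ reg s' rBest = b%:Z,
  reg s' rCand = c%:Z, (b < size ws)%N, (c + k)%N = size ws &
  forall j, (j < c)%N ->
    preferred obj m (summary (nth [::] ws j)) (summary (nth [::] ws b))].
have enc_set s' x z : (1 < x)%N -> encodes ws s' -> encodes ws (set_reg s' x z).
  move=> x1 enc'; apply: encodes_agree enc' _ _ _ => //=; by case: eqP x1 => // <-.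
apply: (@runs_le _ _ (1 + (1 + (4 * size ws).+1))); last by lia.
apply/runs_seq/runs_assign/runs_seq/runs_assign.
apply: (runs_weaken (leqnn _) _ (@runs_while _ _ I 3 _ (size ws) _ _)).
- move=> s' /= [/negPn + [k [enc' [b [c [rB rC bl ck pre]]]]]].
  rewrite rC (enc_len enc') lez_nat => lc; split => //; exists b; split => //.
  by move=> j jl; apply: pre; lia.
- move=> k s1 [enc1 [b [c [rB rC bl ck pre]]]] /=.
  rewrite rC (enc_len enc1) lez_nat -ltnNge => cl.
  pose Q s2 := [/\ encodes ws s2, reg s2 rCand = c%:Z & exists b',
    [/\ reg s2 rBest = b'%:Z, (b' < size ws)%N & forall j, (j < c.+1)%N ->
      preferred obj m (summary (nth [::] ws j)) (summary (nth [::] ws b'))]].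
  have next s2 : Q s2 -> runs (Assign rCand (Add (Reg rCand) (Const 1))) s2 1
      (fun s' => exists2 k', (k' < k)%N & I k' s').
    move=> [enc2 rC2 [b' [rB' b'l pre']]]; apply: runs_assign.
    exists k.-1; first by lia.
    split; first exact: enc_set.
    exists b', c.+1; split => //=; last by lia.
    by rewrite rC2; lia.
  apply: (@runs_le _ _ (2 + 1)) => //.
  apply: runs_seq; apply: (runs_weaken (leqnn _) next).
  apply: runs_if.
    rewrite (holds_preferred_test (e := summary (nth [::] ws b))
      (e' := summary (nth [::] ws c))) => [|k'|k'|] ; rewrite ?(enc_items enc1) //=;
      rewrite ?rB ?rC ?(enc_stored enc1) // => bc.
    apply: runs_assign; split; [exact: enc_set|by []|].
    exists c; split => // j; rewrite ltnS leq_eqVlt => /orP[/eqP->|jc].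
      exact: preferred_refl.
    exact: preferred_trans (pre _ jc) bc.
  rewrite (holds_preferred_test (e := summary (nth [::] ws b))
      (e' := summary (nth [::] ws c))) => [|k'|k'|] ; rewrite ?(enc_items enc1) //=;
      rewrite ?rB ?rC ?(enc_stored enc1) // => /preferred_total bc.
  apply: runs_skip; split => //.
  exists b; split => // j; rewrite ltnS leq_eqVlt => /orP[/eqP-> //|].
  exact: pre.
- split; first by apply: (enc_set) => //; apply: enc_set.
  (* Index 0 is a legitimate first choice because the list contains the empty word. *)
  exists 0%N, 0%N; split => //.
  by have := enc_nil enc; case: (ws).
Qed.

Lemma runs_main U s :
  (forall w, (size w <= m)%N -> forall k, (`|summary w k| <= U)%N) ->
  reg s 0 = m%:Z -> reg s rHead = 0 -> (forall (i : agent) k, arr s i k = d i k) ->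
  (forall k, arr s (aComp k) 0 = 0) ->
  runs (main_prog obj_test) s (time_bound U m)
    (fun s' => exists w, [/\ (size w <= m)%N,
       forall o, (o < size w)%N -> arr s' aOut o%:Z = nth ord0 w o &
       forall w', (size w' <= m)%N -> preferred obj m (summary w') (summary w)]).
Proof.
move=> bndU r0 rH input ar0.
set N := ((2 * U + 1) ^ #|{: coord}|)%N.
have bnd ws s' : encodes ws s' -> (size ws <= N)%N.
  move=> enc; rewrite -(size_map summary); apply: size_box (enc_uniq enc) _.
  by move=> e /mapP[w /(allP (enc_size enc)) wm ->] k; exact: bndU.
rewrite /time_bound -/N; apply: runs_seq; apply: runs_assign.
apply: runs_seq; apply: (runs_weaken (leqnn _) _ (runs_search bnd _ _)) => //; last first.
  (* Zero memory with length 1 encodes the list consisting of the empty word. *)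
  split => //.
  - by case=> // _ k; rewrite /= ar0 /Search.summary /= ffunE.
  - by case.
move=> s1 [ws enc all_w].
have Nl := bnd _ _ enc.
apply: (@runs_le _ _ (4 * size ws + 3 + (3 * m).+1)); last by lia.
apply: runs_seq; apply: (runs_weaken (leqnn _) _ (runs_select enc)).
move=> s2 [enc2 [b [rB bl pre]]].
have bm : (size (nth [::] ws b) <= m)%N by apply: (allP (enc_size enc2)); apply: mem_nth.
apply: runs_weaken (runs_output enc2 rB bl); first by lia.
move=> s3 out; exists (nth [::] ws b); split => // w' /all_w.
move=> /(nthP (summary [::])) [j]; rewrite size_map => jl.
by rewrite (nth_map [::]) // => <-; apply: pre.
Qed.

End Objective.

(** * What a summary records *)

Lemma summary_value w i :
  summary w (Some (None, i)) =
  \sum_(0 <= o < size w) (if nth ord0 w o == i then d i o%:Z else 0).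
Proof.
elim/last_ind: w => [|w j IH]; first by rewrite big_nil /Search.summary /= ffunE.
rewrite summary_rcons ffunE size_rcons big_nat_recr //= nth_rcons ltnn eqxx.
rewrite summary_size IH eq_sym.
rewrite (@eq_big_nat _ _ _ _ _ _
  (fun o => if nth ord0 w o == i then d i o%:Z else 0)); last first.
  by move=> o /andP[_ ow]; rewrite nth_rcons ow.
by case: eqVneq => [->|_] //; rewrite addr0.
Qed.

(** Letting the threshold [x] vary describes the stored minimum without naming it, and includes the
    case where there is none. This is the form in which EQX uses it, with [x] the gap between two
    bundle values. *)
Lemma summary_min w b i x :
  ~~ ((1 <= summary w (Some (Some b, i))) && (summary w (Some (Some b, i)) <= x)) <->
  forall o, (o < size w)%N -> nth ord0 w o = i -> 0 <= signed b (d i o%:Z) ->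
    x <= signed b (d i o%:Z).
Proof.
elim/last_ind: w => [|w j IH]; first by rewrite /Search.summary /= ffunE; split.
rewrite summary_rcons ffunE size_rcons summary_size eq_sym.
(* The last letter is separated from the others, to match one call of [update_min]. *)
have split_last (P : nat -> agent -> Prop) :
    (forall o, (o < (size w).+1)%N -> P o (nth ord0 (rcons w j) o)) <->
    (forall o, (o < size w)%N -> P o (nth ord0 w o)) /\ P (size w) j.
  split=> [H|[H1 H2] o].
    split=> [o ow|]; last by have := H (size w) (ltnSn _); rewrite nth_rcons ltnn eqxx.
    by have := H o (ltnW ow); rewrite nth_rcons ow.
  rewrite ltnS leq_eqVlt nth_rcons => /orP[/eqP ->|ow]; first by rewrite ltnn eqxx.
  by rewrite ow; apply: H1.
rewrite (split_last (fun o a => a = i -> 0 <= signed b (d i o%:Z) ->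
    x <= signed b (d i o%:Z))) -IH.
move: (summary w _) => g; case: eqVneq => [->|ji]; last first.
  by split=> [?|[]//]; split => // ij; rewrite ij eqxx in ji.
move: (signed b _) => y; rewrite /update_min.
case: ifP => [/andP[y0 gy]|gy].
  split=> [H|[H1 /(_ erefl y0) H2]]; last by lia.
  by split=> [|_ _]; lia.
by split=> [H|[]//]; split => // _ y0; lia.
Qed.

(** The count and the bundle values are bounded by [S]; the extra 1 is the shift of the stored
    minima. *)
Lemma summary_bound S w :
  (size w <= m)%N ->
  (forall (i : agent) k, (k <= m)%N -> m + \sum_(0 <= o < k) `|d i o%:Z| <= S)%N ->
  forall k, (`|summary w k| <= S.+1)%N.
Proof.
move=> wm dS [[c i]|]; last by have := dS ord0 0%N; rewrite summary_size; lia.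
case: c => [b|].
  elim/last_ind: w wm => [_|w j IH]; first by rewrite /Search.summary /= ffunE.
  rewrite size_rcons => wm; rewrite summary_rcons ffunE summary_size.
  have := IH (ltnW wm); have := dS i _ wm; rewrite big_nat_recr //=.
  move: (\sum_(_ <= _ < _) _)%N (summary w _) => z g.
  case: eqVneq => [<-|_ _ //]; rewrite /update_min.
  move: (d i _) => y.
  have : `|signed b y|%N = `|y|%N by rewrite /signed; case: (b); lia.
  by move: (signed b y) => y'; case: ifP; lia.
rewrite summary_value; have := dS i _ wm.
suff : (absz (\sum_(0 <= o < size w) (if nth ord0 w o == i then d i o%:Z else 0))%R
   <= \sum_(0 <= o < size w) `|d i o%:Z|)%N by lia.
elim/big_ind2: _ => // [a a' c c'|o _]; first by lia.
by case: ifP; lia.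
Qed.

End Instance.
End Search.
(** * Words and allocations *)

Section Allocations.
Variables n m : nat.
Local Notation agent := 'I_n.+1.

(** The default of [nth] gives all items beyond the end of the word to agent 0, so the result is a
    complete allocation for every word. *)
Definition word_bundles (w : seq agent) : bundles n.+1 m :=
  [ffun i => [set o : 'I_m | nth ord0 w o == i]].

Lemma in_word_bundles w i o : (o \in word_bundles w i) = (nth ord0 w o == i).
Proof. by rewrite ffunE inE. Qed.

Lemma word_bundles_allocation w : is_allocation (word_bundles w).
Proof.
split=> [i j ij|].
  rewrite disjoint_subset; apply/subsetP => o.
  by rewrite !inE !in_word_bundles => /eqP ->.
apply/setP => o; rewrite inE; apply/bigcupP.
by exists (nth ord0 w o); rewrite ?in_word_bundles.
Qed.

Lemma allocation_word (A : bundles n.+1 m) :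
  is_allocation A -> exists2 w, size w = m & A = word_bundles w.
Proof.
move=> [disj cover].
(* Covering provides an owner for each item, so the default is never taken; disjointness makes the
   owner unique. *)
exists [seq odflt ord0 [pick i | o \in A i] | o <- enum 'I_m].
  by rewrite size_map size_enum_ord.
apply/ffunP => i; apply/setP => o; rewrite in_word_bundles.
rewrite (nth_map o) ?size_enum_ord // nth_ord_enum.
case: pickP => [j oj|none] /=.
  case: eqVneq => [<-//|ji]; apply/negbTE/negP => oi.
  by have := disjointFr (disj _ _ ji) oj; rewrite oi.
have : o \in [set: 'I_m] by rewrite inE.
by rewrite -cover => /bigcupP[j _]; rewrite none.
Qed.

Variable v : valuations n.+1 m.
Local Notation d := (arr (initial v)).

Lemma initial_arr (i : agent) (o : 'I_m) : d i (o : nat)%:Z = v i o.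
Proof. by rewrite /= !valK. Qed.

Lemma value_summary w i :
  size w = m -> value v i (word_bundles w i) = summary d w (Some (None, i)).
Proof.
move=> wm; rewrite summary_value wm big_mkord /value -big_mkcond /=.
apply: eq_big => [o|o _]; first by rewrite in_word_bundles.
by rewrite -initial_arr.
Qed.

Lemma value_setD1 i (S : {set 'I_m}) o :
  o \in S -> value v i (S :\ o) = value v i S - v i o.
Proof. by move=> oS; rewrite /value (big_setD1 o oS) /= [RHS]addrC addKr. Qed.

(** Removing a good g from the bundle of j closes the gap between i and j iff the gap is at most the
    value of g; removing a chore c from the bundle of i does so iff the gap is at most minus the
    value of c. Both are comparisons with a stored minimum. *)
Lemma feasible_EQX w :
  size w = m ->
  EQX_allocation v (word_bundles w) <-> feasible m (summary d w).
Proof.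
move=> wm; rewrite /feasible summary_size wm eqxx /=.
have slack b (i j k : agent) :
    within_slack b (summary d w) i j k <->
    forall o, o \in word_bundles w k -> 0 <= signed b (v k o) ->
      value v j (word_bundles w j) - value v i (word_bundles w i)
        <= signed b (v k o).
  rewrite /within_slack summary_min !value_summary // wm; split=> H o.
    by rewrite in_word_bundles -initial_arr => /eqP; apply: H.
  move=> om ok; have := H (Ordinal om); rewrite -initial_arr in_word_bundles /=.
  by apply; apply/eqP.
split=> [[_ eqx]|/allP H].
  apply/allP => -[i j] _; rewrite negb_and negbK -implybE; apply/implyP.
  rewrite -!value_summary // => /eqx [eg ec]; apply/andP; split; apply/slack => o oin /= o0.
    by have := eg o oin o0; rewrite value_setD1 //; lia.
  have : v i o <= 0 by lia.
  by move=> /(ec o oin); rewrite value_setD1 //; lia.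
split; first exact: word_bundles_allocation.
move=> i j lt_ij.
have := H (i, j) (mem_enum _ _); rewrite -!value_summary // lt_ij negbK.
move=> /andP[/slack sg /slack sc]; split=> o oin o0.
  by have := sg o oin o0; rewrite value_setD1 //=; lia.
have {}o0 : 0 <= signed false (v i o) by rewrite /=; lia.
by have := sc o oin o0; rewrite value_setD1 //=; lia.
Qed.

End Allocations.

(** * From the search to pseudo-polynomial computability *)

Lemma initial_bound n m (v : valuations n.+1 m) (i : 'I_n.+1) k :
  (k <= m)%N ->
  (m + \sum_(0 <= o < k) `|arr (initial v) i o%:Z| <= unary_size v)%N.
Proof.
move=> km; rewrite leq_add2l (bigD1 i) //=; apply: leq_trans (leq_addr _ _).
apply: (@leq_trans (\sum_(0 <= o < m) `|arr (initial v) i o%:Z|)%N).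
  by rewrite [leqRHS](big_cat_nat (n := k)) //= leq_addr.
by rewrite big_mkord; apply: leq_sum => o _; rewrite initial_arr.
Qed.

(** Here [U] plays the role of the unary size: it bounds m, and [U.+1] bounds the components of
    summaries. The exponent [K] is constant for fixed [n]. *)
Lemma time_bound_polynomial n :
  is_polynomial (fun U => time_bound n U.+1 U).
Proof.
rewrite /time_bound; set K := #|_|.
have polyN : is_polynomial (fun U => (2 * U.+1 + 1) ^ K)%N.
  apply: is_polynomial_exp; apply: is_polynomial_add; last exact: is_polynomial_const.
  apply: is_polynomial_mul; first exact: is_polynomial_const.
  by apply: is_polynomial_succ; exact: is_polynomial_id.
repeat first [exact: is_polynomial_const | exact: is_polynomial_id | exact: polyN
  | apply: is_polynomial_succ | apply: is_polynomial_add | apply: is_polynomial_mul].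
Qed.

(** Any welfare that is monotone in an integer objective of the summary can be maximized, provided
    that a [test] compares this objective. The welfare itself is never computed. *)
Lemma max_EQX_computable n (obj : entry n -> int)
    (obj_test : (coord n -> expr) -> (coord n -> expr) -> test)
    (dT : Order.disp_t) (T : porderType dT)
    (W : forall m, valuations n.+1 m -> bundles n.+1 m -> T) :
  (forall s f g (e e' : entry n),
    (forall k, eval s (f k) = e k) -> (forall k, eval s (g k) = e' k) ->
    holds s (obj_test f g) = (obj e <= obj e')) ->
  (forall m (v : valuations n.+1 m) (A B : bundles n.+1 m) (e e' : entry n),
    (forall i, value v i (A i) = e (Some (None, i))) ->
    (forall i, value v i (B i) = e' (Some (None, i))) ->
    obj e <= obj e' -> (W m v A <= W m v B)%O) ->
  pseudo_poly_time_computable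
    (fun m (v : valuations n.+1 m) => exists A, EQX_allocation v A)
    (fun m (v : valuations n.+1 m) A => max_EQX (@W m) v A).
Proof.
move=> testP objP; have [p pE] := time_bound_polynomial n.
exists (main_prog obj_test), p => m v.
set U := unary_size v.
have bnd := fun w wm => @summary_bound n (arr (initial v)) m U w wm (@initial_bound n m v).
have ar0 k : arr (initial v) (aComp (n := n) k) 0 = 0.
  by rewrite /= insubF // /aComp; apply/negbTE; rewrite -leqNgt; lia.
have [t [s [ex tT [w [wm out best]]]]] :=
  runs_main testP bnd (erefl : reg (initial v) 0 = m%:Z) erefl (fun _ _ => erefl) ar0.
exists t, s; split => //.
  rewrite -pE; apply: leq_trans tT _; rewrite /time_bound.
  by rewrite leq_add2l leq_add2l leq_add2l ltnS leq_mul2l leq_addr orbT.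
move=> [B0 B0eqx]; have [w0 w0m B0E] := allocation_word B0eqx.1.
(* The promise yields one feasible summary, which forces the selected one to be feasible, since
   infeasible entries rank below. *)
have feas0 : feasible m (summary (arr (initial v)) w0).
  by apply/feasible_EQX; rewrite // -B0E.
have best_feas w' : size w' = m -> feasible m (summary (arr (initial v)) w') ->
    feasible m (summary (arr (initial v)) w) /\
    obj (summary (arr (initial v)) w') <= obj (summary (arr (initial v)) w).
  move=> w'm fw'; have := best w'; rewrite w'm => /(_ (leqnn _)).
  by rewrite /preferred fw' /= negbK => /andP.
have [feas _] := best_feas _ w0m feas0.
(* Feasibility includes that all items are allocated, so the default of [nth] does not interfere. *)
have {}wm : size w = m.
  by move: feas; rewrite /feasible summary_size => /andP[/eqP[]].
exists (word_bundles m w); split.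
  by move=> i o; rewrite in_word_bundles out ?wm // eqz_nat.
split; first by apply/feasible_EQX.
move=> B Beqx; have [w' w'm BE] := allocation_word Beqx.1.
have [_ le] : feasible m (summary (arr (initial v)) w) /\
    obj (summary (arr (initial v)) w') <= obj (summary (arr (initial v)) w).
  by apply: best_feas => //; apply/feasible_EQX; rewrite // -BE.
by rewrite BE; apply: objP le => i; apply: value_summary.
Qed.

(** * The two welfare objectives *)

Definition sum_entry n (e : entry n) : int := \sum_i e (Some (None, i)).

Definition sum_expr n (f : coord n -> expr) : expr :=
  foldr (fun i z => Add (f (Some (None, i))) z) (Const 0) (enum 'I_n.+1).

Definition min_entry n (e : entry n) : int :=
  \big[Order.min/e (Some (None, ord0))]_i e (Some (None, i)).

Lemma min_entry_attained n (e : entry n) :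
  exists i, min_entry e = e (Some (None, i)).
Proof.
rewrite /min_entry; elim/big_ind: _ => [|x y [i ->] [j ->]|i _].
- by exists ord0.
- by rewrite /Order.min; case: ifP; [exists i|exists j].
- by exists i.
Qed.

Lemma min_entry_le n (e : entry n) i : min_entry e <= e (Some (None, i)).
Proof. exact: bigmin_le. Qed.

(* Expressions cannot branch, so minima are compared by a for-all-exists test. *)
Definition min_test n (f g : coord n -> expr) : test :=
  all_test (fun i => Not (all_test (fun j =>
      Not (Le (f (Some (None, j))) (g (Some (None, i))))) (enum 'I_n.+1)))
    (enum 'I_n.+1).

(** One minimum is at most another iff each value on the right dominates some value on the left;
    minimizers give both directions. *)
Lemma holds_min_test n s f g (e e' : entry n) :
  (forall k, eval s (f k) = e k) -> (forall k, eval s (g k) = e' k) ->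
  holds s (min_test f g) = (min_entry e <= min_entry e').
Proof.
move=> fe ge; rewrite holds_all_test; apply/allP/idP => [H|le i _] /=.
  have [i ->] := min_entry_attained e'.
  have /= := H i (mem_enum _ i); rewrite holds_all_test -has_predC.
  move=> /hasP[j _] /=; rewrite fe ge negbK.
  exact: le_trans (min_entry_le e j).
rewrite holds_all_test -has_predC; apply/hasP.
have [j ej] := min_entry_attained e; exists j; first exact: mem_enum.
by rewrite /= fe ge negbK -ej (le_trans le) // min_entry_le.
Qed.

Theorem theorem6p1 (n : nat) :
  pseudo_poly_time_computable
    (fun m (v : valuations n.+1 m) => exists A, EQX_allocation v A)
    (fun m (v : valuations n.+1 m) A => max_EQX (@utilitarian n.+1 m) v A)
  /\
  pseudo_poly_time_computable
    (fun m (v : valuations n.+1 m) => exists A, EQX_allocation v A)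
    (fun m (v : valuations n.+1 m) A => max_EQX (@egalitarian n m) v A).
Proof.
split.
- apply: (@max_EQX_computable n (@sum_entry n)
    (fun f g => Le (sum_expr f) (sum_expr g))) => [s f g e e' fe ge|m v A B e e' Ae Be].
    have sumE h (e1 : entry n) : (forall k, eval s (h k) = e1 k) ->
        eval s (sum_expr h) = sum_entry e1.
      move=> he; rewrite /sum_expr /sum_entry -big_enum.
      by elim: (enum _) => [|i l IH] /=; rewrite ?big_nil // big_cons he IH.
    by rewrite /= (sumE _ _ fe) (sumE _ _ ge).
  rewrite /utilitarian /sum_entry => le.
  (* The factor 1/n is nonnegative, so comparing the integer sums is enough. *)
  rewrite ler_wpM2l ?invr_ge0 ?ler0n // ler_int.
  by under eq_bigr do rewrite Ae; under [leRHS]eq_bigr do rewrite Be.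
- apply: (@max_EQX_computable n (@min_entry n) (@min_test n)) => [s f g e e'|m v A B e e' Ae Be].
    exact: holds_min_test.
  have egalE (C : bundles n.+1 m) (e1 : entry n) :
      (forall i, value v i (C i) = e1 (Some (None, i))) ->
      egalitarian v C = min_entry e1.
    by move=> Ce; rewrite /min_entry -(Ce ord0); apply: eq_bigr => i _; apply: Ce.
  by rewrite (egalE _ _ Ae) (egalE _ _ Be).
Qed.
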